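(* Let $\{U_\sigma(t,s):t\ge s\}_{\sigma\in\Sigma}$ be a system of evolution processes in the Banach space $X$, let $\psi\in\Sigma$, and suppose that $\{U_\psi(t,s):t\ge s\}$ has a pullback attractor $\{A(t):t\in\mathbb{R}\}$. Let $\mathcal{B}\subset X$ be a closed, bounded, uniformly absorbing set of the system, and suppose the following. (1) There is a Banach space $Y$ compactly embedded in $X$. (2) For every $t>0$ there is $\kappa(t)>0$ such that $$\sup_{\sigma\in\Sigma}\|U_\sigma(t,0)x-U_\sigma(t,0)y\|_Y\le\kappa(t)\|x-y\|_X\quad\text{for all }x,y\in\mathcal{B}.$$ (3) There are $\gamma,\theta\in(0,1]$ and, for each $r>0$, a constant $C(r)$ such that for all $s\in\mathbb{R}$, $\sigma\in\Sigma$, $x,y\in\mathcal{B}$ and $t,\tilde t\in[0,r]$, $$\|U_\sigma(t+s,s)x-U_\sigma(\tilde t+s,s)y\|_X\le C(r)\left(\|x-y\|_X^\gamma+|t-\tilde t|^\theta\right).$$ (4) There exist sets $\mathcal{A}_-,\mathcal{A}_+\subset X$ with $d_B(\mathcal{A}_-)=d_-<\infty$ and $d_B(\mathcal{A}_+)=d_+<\infty$, a strictly decreasing function $f:(0,\infty)\to(0,\infty)$ with $f(t)\to0$ as $t\to\infty$, and $\tilde T\ge0$, such that $\mathrm{dist}_H(A(t),\mathcal{A}_+)\le f(t)$ for all $t\ge\tilde T$, $t\neq 0$, and $\mathrm{dist}_H(A(t),\mathcal{A}_-)\le f(|t|)$ for all $t\le-\tilde T$, $t\ne 0$. Let $\tau>0$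 be such that $\bigcup_{\sigma\in\Sigma}U_\sigma(t,0)\mathcal{B}\subset\mathcal{B}$ for all $t\ge\tau$, and let $N_{\frac{1}{4\kappa(\tau)}}$ denote the number of balls of radius $\frac{1}{4\kappa(\tau)}$ in $X$ necessary to cover the unit ball $B_Y(0,1)$ of $Y$. Then: (T1) If $f(t)=K/t^r$ for some $K\ge1$ and $r\in(0,\infty)$, then $$d_B\Big(\bigcup_{t\in\mathbb{R}}A(t)\Big)\le\max\Big(d_+,\,d_-,\,\frac1r+\frac1\theta+\frac1\gamma\log_2N_{\frac{1}{4\kappa(\tau)}}\Big).$$ (T2) If $f(t)=Ke^{-\xi t}$ for some $K\ge1$ and $\xi>0$, then $$d_B\Big(\bigcup_{t\in\mathbb{R}}A(t)\Big)\le\max\Big(d_+,\,d_-,\,\frac1\theta+\frac1\gamma\log_2N_{\frac{1}{4\kappa(\tau)}}\Big).$$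
   Context: $(X,\|\cdot\|_X)$ is a Banach space. An evolution process in $X$ is a family of continuous maps $U(t,s):X\to X$, $t\ge s$ real, with $U(s,s)=\mathrm{Id}_X$, $U(t,s)U(s,r)=U(t,r)$ for $t\ge s\ge r$, and such that for each $x\in X$ the map $(t,s)\mapsto U(t,s)x$ is continuous on $\{t\ge s\}$. $(\Xi,d_\Xi)$ is a complete metric space, $\{\theta_t:t\in\mathbb{R}\}$ is a group of continuous maps $\theta_t:\Xi\to\Xi$ ($\theta_0=\mathrm{Id}$, $\theta_t\theta_s=\theta_{t+s}$), and $\Sigma\subset\Xi$ (the symbol space) is compact with $\theta_t\Sigma=\Sigma$ for all $t\in\mathbb{R}$. (The operators $\theta_t$ are unrelated to the Hölder exponent $\theta$.) A system of evolution processes $\{U_\sigma(t,s):t\ge s\}_{\sigma\in\Sigma}$ is a family of evolution processes in $X$ indexed by $\sigma\in\Sigma$ such that $U_{\theta_h\sigma}(t,s)=U_\sigma(t+h,s+h)$ for all $\sigma\in\Sigma$, $t\ge s$, $h\in\mathbb{R}$. A set $\mathcal{B}\subset X$ is uniformly absorbing if for each bounded $B\subset X$ there is $t_B\ge0$ such that $U_\sigma(t,0)B\subset\mathcal{B}$ for all $t\ge t_B$, $\sigma\in\Sigma$. $\mathrm{dist}_H(A,B)=\sup_{x\in A}\inf_{y\in B}\|x-y\|_X$ is the Hausdorff semi-distance. The pullback attractor of an evolution process $\{U(t,s)\}$ is a family $\{A(t):t\in\mathbb{R}\}$ of compact subsets of $X$ with $\bigcup_{t\in\mathbb{R}}A(t)$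 bounded, $U(t,s)A(s)=A(t)$ for all $t\ge s$, and $\mathrm{dist}_H(U(t,s)B,A(t))\to0$ as $s\to-\infty$ for every $t\in\mathbb{R}$ and bounded $B\subset X$. For $K\subset X$ and $r>0$, $N_X(K,r)$ is the minimal number of open balls of $X$ of radius $r$ needed to cover $K$, and the box-counting dimension is $d_B(K)=\limsup_{r\to0}\frac{\log N_X(K,r)}{-\log r}$. *)

(* Defs.v *)
From HB Require Import structures.
From mathcomp Require Export all_boot all_order all_algebra.
From mathcomp Require Export all_classical all_reals all_analysis.

Set Implicit Arguments.
Unset Strict Implicit.
Unset Printing Implicit Defensive.
Import Order.TTheory GRing.Theory Num.Theory.
Import numFieldNormedType.Exports.
Local Open Scope classical_set_scope.
Local Open Scope ring_scope.

(* A two-parameter family is a total function [U : R -> R -> X -> X]; only the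
   values [U t s] with [s <= t] are meaningful. *)
Record evolution_process {R : realType} {X : completeNormedModType R}
    (U : R -> R -> X -> X) : Prop := EvolutionProcess {
  ep_continuous : forall t s, s <= t -> continuous (U t s);
  ep_id : forall s x, U s s x = x;
  ep_comp : forall t s r, r <= s -> s <= t ->
    forall x, U t s (U s r x) = U t r x;
  ep_orbit_continuous : forall x,
    {within [set p : R * R | p.2 <= p.1], continuous (fun p => U p.1 p.2 x)}
}.

(* Stated through the metric uniformity, in terms of Cauchy filters: Metric
   and Complete have no joint structure in the library. *)
Definition complete_metric {R : realType} (Xi : metricType R) : Prop :=
  forall F : set_system Xi, ProperFilter F -> cauchy F ->
    exists l : Xi, F --> l.

Record symbol_space {R : realType} {Xi : metricType R}
    (theta : R -> Xi -> Xi) (Sigma : set Xi) : Prop := SymbolSpace {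
  ss_continuous : forall t, continuous (theta t);
  ss_id : forall s, theta 0 s = s;
  ss_comp : forall t h s, theta (t + h) s = theta t (theta h s);
  ss_compact : compact Sigma;
  ss_invariant : forall t, theta t @` Sigma = Sigma
}.

(* The family is indexed by all of [Xi], but only its members with symbol in
   [Sigma] are constrained. *)
Definition evolution_system {R : realType} {X : completeNormedModType R}
    {Xi : metricType R} (theta : R -> Xi -> Xi) (Sigma : set Xi)
    (U : Xi -> R -> R -> X -> X) : Prop :=
  (forall s, Sigma s -> evolution_process (U s)) /\
  (forall sigma t s h x, Sigma sigma -> s <= t ->
     U (theta h sigma) t s x = U sigma (t + h) (s + h) x).

Definition uniformly_absorbing {R : realType} {X : completeNormedModType R}
    {Xi : metricType R} (Sigma : set Xi) (U : Xi -> R -> R -> X -> X)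
    (B0 : set X) : Prop :=
  forall B : set X, bounded_set B -> exists2 tB : R, 0 <= tB &
    forall t sigma, tB <= t -> Sigma sigma -> U sigma t 0 @` B `<=` B0.

(* The supremum is taken in [0, +oo], whence the [maxe 0]: without it the
   semi-distance from the empty set would be -oo. *)
Definition hausdorff_semidist {R : realType} {X : completeNormedModType R}
    (A B : set X) : \bar R :=
  maxe 0%E (ereal_sup [set ereal_inf [set `|x - y|%:E | y in B] | x in A]).

Record pullback_attractor {R : realType} {X : completeNormedModType R}
    (U : R -> R -> X -> X) (A : R -> set X) : Prop := PullbackAttractor {
  pa_compact : forall t, compact (A t);
  pa_bounded : bounded_set (\bigcup_t A t);
  pa_invariant : forall t s, s <= t -> U t s @` A s = A t;
  pa_attracts : forall t (B : set X), bounded_set B ->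
    hausdorff_semidist (U t s @` B) (A t) @[s --> -oo%R] --> 0%E
}.

(* +oo when no finite cover exists; the centres range over the whole space. *)
Definition covering_number {R : realType} {X : completeNormedModType R}
    (K : set X) (r : R) : \bar R :=
  ereal_inf [set (size c)%:R%:E | c in
    [set c : seq X | K `<=` \bigcup_(a in [set` c]) ball a r]].

Definition box_dim {R : realType} {X : completeNormedModType R}
    (K : set X) : \bar R :=
  limf_esup (fun r : R => (lne (covering_number K r) / (- ln r)%:E)%E) 0^'+.

Definition elog2 {R : realType} (x : \bar R) : \bar R :=
  (lne x / (ln 2)%:E)%E.

Definition compact_embedding {R : realType} {X Y : completeNormedModType R}
    (j : {linear Y -> X}) : Prop :=
  [/\ injective j, continuous j &
      forall B : set Y, bounded_set B -> precompact (j @` B)].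

(* The norm of [Y] read on elements of [X] through the embedding [j]: the
   infimum is over at most one value, and is +oo for [x] outside the range
   of [j], so that a finite bound includes membership in [Y]. *)
Definition embedded_norm {R : realType} {X Y : completeNormedModType R}
    (j : {linear Y -> X}) (x : X) : \bar R :=
  ereal_inf [set `|y|%:E | y in [set y | j y = x]].

(* Main.v *)
(* The smoothing estimate maps a ball of radius rho centred in A(s) into N balls
   of radius rho / 2 centred in A(s + tau), where N is the covering number of
   the unit ball of Y at radius 1 / (4 kappa(tau)).  Iterating from a large
   ball, every section A(t) is covered by about eps^(- log2 N) balls of radius eps,
   uniformly in t.  Given d > 0, put T = eps^(- (a + d)) with a = 1 / r in the
   polynomial case and a = 0 in the exponential case: the sections with
   |t| >= T lie within eps / 2 of Aplus or Aminus, while the time interval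
   [-T, T] is cut into about T eps^(- (1 / vartheta + d)) pieces, on each of which
   the Hoelder continuity in time moves the sections by less than eps / 2. *)
Require Import Defs.
From HB Require Import structures.
From mathcomp Require Import all_boot all_order all_algebra.
From mathcomp Require Import all_classical all_reals all_analysis.
From mathcomp Require Import ring lra.

Set Implicit Arguments.
Unset Strict Implicit.
Unset Printing Implicit Defensive.
Import Order.TTheory GRing.Theory Num.Theory.
Import numFieldNormedType.Exports.
Local Open Scope classical_set_scope.
Local Open Scope ring_scope.

(** * Finite covers by balls, and their link with the box-counting dimension *)

Section Covers.
Context {R : realType} {X : completeNormedModType R}.
Implicit Types (K L : set X) (r d e : R) (k m : nat).

Lemma mem_ball_norm (a y : X) r : ball a r y = (`|a - y| < r) :> Prop.
Proof. by rewrite -(@ball_normE R X). Qed.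

(** A bound by a natural number replaces the extended-real covering number in all counting
    arguments; the centres may lie anywhere in [X]. *)
Definition coverable K r k : Prop :=
  exists2 c : seq X, K `<=` \bigcup_(a in [set` c]) ball a r & (size c <= k)%N.

(** Centres inside [K] are required because the smoothing estimate compares only points of the set
    itself. *)
Definition self_coverable K r k : Prop :=
  exists c : seq X, [/\ {in c, forall a, K a},
    K `<=` \bigcup_(a in [set` c]) ball a r & (size c <= k)%N].

Lemma self_coverableW K r k : self_coverable K r k -> coverable K r k.
Proof. by move=> [c [_ Kc ck]]; exists c. Qed.

Lemma coverable_le_radius K r d k :
  r <= d -> coverable K r k -> coverable K d k.
Proof.
move=> rd [c Kc ck]; exists c => // x /Kc[a ac]; rewrite mem_ball_norm => ax.
by exists a => //; rewrite mem_ball_norm (lt_le_trans ax).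
Qed.

Lemma coverable_sub K L r k : K `<=` L -> coverable L r k -> coverable K r k.
Proof. by move=> KL [c Lc ck]; exists c => // x /KL/Lc. Qed.

Lemma coverable0 r k : coverable set0 r k.
Proof. by exists [::]. Qed.

Lemma coverableU K L r k m :
  coverable K r k -> coverable L r m -> coverable (K `|` L) r (k + m).
Proof.
move=> [c Kc ck] [c' Lc ck'].
exists (c ++ c'); last by rewrite size_cat leq_add.
move=> x [/Kc|/Lc] [a /= ac xa]; exists a => //=; rewrite mem_cat ac ?orbT//.
Qed.

Lemma coverable_bigcup (F : nat -> set X) r k m :
  (forall i, coverable (F i) r k) ->
  coverable (\bigcup_(i in [set i | (i < m)%N]) F i) r (m * k).
Proof.
move=> FP; elim: m => [|m [c Fc cm]].
  by rewrite (_ : \bigcup_(_ in _) _ = set0) ?bigcup0//; exact: coverable0.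
rewrite mulSnr; have [c' Fc' cm'] := FP m.
exists (c ++ c'); last by rewrite size_cat leq_add.
move=> x [i /=]; rewrite ltnS leq_eqVlt => /predU1P[->|im] Fx.
  by have [a /= ac xa] := Fc' _ Fx; exists a => //=; rewrite mem_cat ac orbT.
have [|a /= ac xa] := Fc x; first by exists i.
by exists a => //=; rewrite mem_cat ac.
Qed.

Lemma coverable_thicken K L r e k :
  (forall x, K x -> exists2 y, L y & `|x - y| < e) ->
  coverable L r k -> coverable K (r + e) k.
Proof.
move=> KL [c Lc ck]; exists c => // x /KL[y /Lc[a ac]].
rewrite mem_ball_norm => ay xy; exists a => //.
rewrite mem_ball_norm -(subrKA y) (le_lt_trans (ler_normD _ _))// ltrD//.
by rewrite distrC.
Qed.

(** Each centre is replaced by a point of [K] in its ball, if there is one, at the price of doubling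
    the radius. *)
Lemma coverable_recenter K r k :
  coverable K r k -> self_coverable K (r + r) k.
Proof.
move=> [c Kc ck].
have [->|/set0P[x0 Kx0]] := eqVneq K set0; first by exists [::]; split.
(* A ball that misses [K] gets the default point [x0] of [K], so every new centre lies in [K]. *)
pose g a := xget x0 (K `&` ball a r).
have Kg a : K (g a).
  have [[z Pz]|nP] := pselect (exists z, (K `&` ball a r) z).
    by have [] := xgetI x0 Pz.
  by rewrite /g xgetPN// => z Pz; apply: nP; exists z.
exists [seq g a | a <- c]; split; last by rewrite size_map.
  by move=> _ /mapP[a _ ->].
move=> x Kx; have [a /= ac ax] := Kc _ Kx.
exists (g a); first by apply/mapP; exists a.
have [_ ga] := xgetI x0 (conj Kx ax : (K `&` ball a r) x).
by apply: ball_triangle ax; exact: ball_sym.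
Qed.

Lemma covering_number_le K r k :
  coverable K r k -> (covering_number K r <= k%:R%:E)%E.
Proof.
move=> [c Kc ck]; apply: ge_ereal_inf; exists (size c)%:R%:E.
  by exists c.
by rewrite lee_fin ler_nat.
Qed.

Lemma coverable_lt K r (u : \bar R) : (covering_number K r < u)%E ->
  exists2 k, coverable K r k & (k%:R%:E < u)%E.
Proof.
by move=> /ereal_inf_lt[_ [c Kc <-] cu]; exists (size c) => //; exists c.
Qed.

(** An infimum of natural numbers is a minimum; this lets $N$ be replaced by a natural number. *)
Lemma covering_number_attained K r k : coverable K r k ->
  exists2 m, coverable K r m & covering_number K r = m%:R%:E.
Proof.
move=> Kk; have ex : exists m, `[< coverable K r m >].
  by exists k; exact/asboolP.
pose m := ex_minn ex; have [/asboolP mP mmin] : `[< coverable K r m >] /\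
    forall n, `[< coverable K r n >] -> (m <= n)%N.
  by rewrite /m; case: ex_minnP.
exists m => //; apply/eqP; rewrite eq_le covering_number_le//=.
apply: le_ereal_inf_tmp => _ [c Kc <-]; rewrite lee_fin ler_nat.
by apply: mmin; apply/asboolP; exists c.
Qed.

(** The upper limit lies strictly below $d+e$, so the quotient does too for all small [r];
    multiplying by $-\ln r>0$ and exponentiating gives the count. *)
Lemma box_dim_coverable K d e : box_dim K = d%:E -> 0 < e ->
  \forall r \near 0^'+,
    exists2 k, coverable K r k & k%:R < r `^ (- (d + e)).
Proof.
move=> dK e0.
have : (box_dim K < (d + e)%:E)%E by rewrite dK lte_fin ltrDl.
rewrite /box_dim limf_esupE => /ereal_inf_lt[_ [V V0 <-] supV].
near=> r.
have r0 : 0 < r by near: r; exact: nbhs_right_gt.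
have r1 : r < 1 by near: r; exact: nbhs_right_lt.
have lnr : 0 < - ln r by rewrite oppr_gt0 ln_lt0// r0 r1.
have Vr : V r by near: r; exact: V0.
have : (lne (covering_number K r) / (- ln r)%:E < (d + e)%:E)%E.
  by apply: le_lt_trans supV; apply: ereal_sup_ubound; exists r.
rewrite inver gt_eqF// lte_pdivrMr// -EFinM.
rewrite -lte_expeR lneK; last first.
  by rewrite in_itv/= leey andbT; apply: le_ereal_inf_tmp => _ [c _ <-].
move=> /coverable_lt[k Kk]; rewrite lte_fin => kd; exists k => //.
by rewrite /powR gt_eqF// mulNr -mulrN.
Unshelve. all: by end_near. Qed.

Lemma box_dim_le K d :
  (forall e, 0 < e -> \forall r \near 0^'+,
    exists2 k, coverable K r k & k%:R <= r `^ (- (d + e))) ->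
  (box_dim K <= d%:E)%E.
Proof.
move=> Kd; apply/lee_addgt0Pr => e e0; rewrite /box_dim limf_esupE -EFinD.
set g := fun r => (_ / _)%E; apply: ge_ereal_inf.
(* The neighbourhood in the upper limit is the sublevel set of [g] itself, so only its being a
   neighbourhood needs the hypothesis. *)
exists (ereal_sup (g @` [set r | (g r <= (d + e)%:E)%E])).
  eexists; last by reflexivity.
  near=> r.
  have r0 : 0 < r by near: r; exact: nbhs_right_gt.
  have r1 : r < 1 by near: r; exact: nbhs_right_lt.
  have lnr : 0 < - ln r by rewrite oppr_gt0 ln_lt0// r0 r1.
  have [k Kk kd] : exists2 k, coverable K r k & k%:R <= r `^ (- (d + e)).
    by near: r; exact: Kd.
  rewrite /= /g inver gt_eqF// lee_pdivrMr// -EFinM -lee_expeR lneK; last first.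
    by rewrite in_itv/= leey andbT; apply: le_ereal_inf_tmp => _ [c _ <-].
  apply: le_trans (covering_number_le Kk) _; rewrite lee_fin.
  by move: kd; rewrite /powR gt_eqF// mulNr -mulrN.
by apply: ge_ereal_sup => _ [r /= rP <-].
Unshelve. all: by end_near. Qed.

End Covers.

(** * Covers of the sections: iterated smoothing, then motion in time *)

Section Smoothing.
Context {R : realType} {X Y : completeNormedModType R} (j : {linear Y -> X}).
Implicit Types (K : set X) (r rho : R) (k m : nat).

Lemma embedded_norm_lt (x : X) (u : R) : (embedded_norm j x < u%:E)%E ->
  exists2 y, j y = x & `|y| < u.
Proof. by move=> /ereal_inf_lt[_ [y <- <-]]; rewrite lte_fin; exists y. Qed.

Lemma precompact_coverable K r : 0 < r -> precompact K ->
  exists k, coverable K r k.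
Proof.
move=> r0; rewrite precompactE compact_cover => /(_ X setT (ball ^~ r)).
case=> [a _|x Kx|D _ KD]; first exact: ball_open.
  by exists x => //; exact: ballxx.
exists (size (finmap.enum_fset D)), (finmap.enum_fset D) => // x Kx.
by have [a aD ax] := KD _ (subset_closure Kx); exists a.
Qed.

(** If [x] is within [rho] of a centre [a], then [S x - S a] comes from the ball of radius
    [kappa * rho] of [Y]. The cover of the unit ball of [Y], scaled by this factor, has balls of
    radius [rho / 4] in [X]. *)
Lemma smoothing_self_coverable (S : X -> X) K (kappa rho : R) k m :
  0 < kappa -> 0 < rho ->
  coverable (j @` ball 0 1) (1 / (4 * kappa)) m ->
  (forall x y, K x -> K y ->
    (embedded_norm j (S x - S y)%R <= (kappa * `|x - y|)%:E)%E) ->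
  self_coverable K rho k -> self_coverable (S @` K) (rho / 2) (k * m).
Proof.
move=> kappa0 rho0 [c0 Yc0 c0m] SK [c [cK Kc ck]].
have kr0 : 0 < kappa * rho by rewrite mulr_gt0.
have -> : rho / 2 = rho / 4 + rho / 4 by lra.
apply: coverable_recenter.
exists [seq S a + (kappa * rho) *: b | a <- c, b <- c0]; last first.
  by rewrite size_allpairs leq_mul.
move=> _ [x Kx <-]; have [a /= ac] := Kc _ Kx; rewrite mem_ball_norm => ax.
have [y jy yr] : exists2 y, j y = S x - S a & `|y| < kappa * rho.
  apply: embedded_norm_lt; apply: le_lt_trans (SK _ _ Kx (cK _ ac)) _.
  by rewrite lte_fin ltr_pM2l// distrC.
have [|b /= bc0] := Yc0 (j ((kappa * rho)^-1 *: y)).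
  exists ((kappa * rho)^-1 *: y) => //.
  rewrite mem_ball_norm sub0r normrN normrZ.
  by rewrite gtr0_norm ?invr_gt0// ltr_pdivrMl// mulr1.
rewrite mem_ball_norm linearZ/= jy => bS.
exists (S a + (kappa * rho) *: b); first by apply/allpairsP; exists (a, b).
rewrite mem_ball_norm.
have -> : S a + (kappa * rho) *: b - S x =
    (kappa * rho) *: (b - (kappa * rho)^-1 *: (S x - S a)).
  rewrite scalerBr scalerA mulfV ?gt_eqF// scale1r opprB.
  by rewrite [RHS]addrC addrAC.
rewrite normrZ gtr0_norm// -ltr_pdivlMl//; apply: lt_le_trans bS _.
by rewrite le_eqVlt; apply/orP; left; apply/eqP; field; rewrite !gt_eqF.
Qed.

(** A(t) is the image of A(t - tau), so each step back in time halves the radius and multiplies the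
    count by [m]. The start is one ball of radius [R0] around any point of a section, which makes
    the bound uniform in [t]. *)
Lemma smoothing_iter_self_coverable (A : R -> set X) (S : R -> X -> X)
    (kappa tau R0 : R) m :
  0 < kappa -> 0 < R0 ->
  coverable (j @` ball 0 1) (1 / (4 * kappa)) m ->
  (forall s, S s @` A s = A (s + tau)) ->
  (forall s x y, A s x -> A s y ->
    (embedded_norm j (S s x - S s y)%R <= (kappa * `|x - y|)%:E)%E) ->
  (forall s x y, A s x -> A s y -> `|x - y| < R0) ->
  forall n t, self_coverable (A t) (R0 / 2 ^+ n) (m ^ n).
Proof.
move=> kappa0 R00 Ym SA SK AR; elim=> [|n IHn] t.
  rewrite expr0 divr1 expn0.
  have [->|/set0P[x0 Ax0]] := eqVneq (A t) set0; first by exists [::]; split.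
  exists [:: x0]; split=> // [a|x Ax]; first by rewrite inE => /eqP->.
  by exists x0; rewrite ?mem_ball_norm/= ?inE//; exact: AR Ax0 Ax.
rewrite -[t](subrK tau) -SA expnSr exprSr invfM mulrA.
apply: (smoothing_self_coverable kappa0 _ Ym) (IHn _).
- by rewrite divr_gt0// exprn_gt0.
- exact: SK.
Qed.

(** Every time in the interval follows some grid point [- T + i * eta] by less than [eta], so its
    section lies within [e] of the section at that grid point. *)
Lemma coverable_trajectory (A : R -> set X) (T eta e : R) k :
  0 < eta ->
  (forall s t x, s <= t <= s + eta -> A t x ->
    exists2 y, A s y & `|x - y| < e) ->
  (forall s, coverable (A s) e k) ->
  coverable (\bigcup_(t in [set t | - T <= t <= T]) A t) (e + e)
    ((Num.truncn (2 * T / eta)).+1 * k).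
Proof.
move=> eta0 At Ak; pose s i := - T + i%:R * eta.
apply: (@coverable_thicken _ _ _
  (\bigcup_(i in [set i | (i < (Num.truncn (2 * T / eta)).+1)%N]) A (s i))).
  move=> x [t /= /andP[Tt tT] Ax].
  have tT0 : 0 <= (t + T) / eta by rewrite divr_ge0 ?(ltW eta0)//; lra.
  pose i := Num.truncn ((t + T) / eta).
  have /andP[it ti] : i%:R <= (t + T) / eta < i.+1%:R by exact: truncn_itv.
  have [|y Ay xy] := At (s i) t x _ Ax.
    move: it ti; rewrite ler_pdivlMr// ltr_pdivrMr// -natr1 /s => it ti.
    by apply/andP; split; nra.
  exists y => //; exists i => //=; rewrite ltnS.
  by apply: le_truncn; rewrite ler_pM2r ?invr_gt0//; lra.
exact: coverable_bigcup.
Qed.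

End Smoothing.

(** * Elementary asymptotics for small radii and the two decay laws *)

Section Asymptotics.
Context {R : realType}.
Implicit Types (p c r a d e : R).

Lemma near_powR_lt p c : 0 < p -> 0 < c -> \forall r \near 0^'+, r `^ p < c.
Proof. by move=> p0 c0; apply: cvgr_lt (powR_cvg0 p0) _ c0. Qed.

Lemma near_half (P : R -> Prop) :
  (\forall r \near 0^'+, P r) -> \forall r \near 0^'+, P (r / 2).
Proof.
move=> [e /= e0 eP]; exists e => //= r; rewrite /ball_/= sub0r normrN => re r0.
have re0 : r < e by rewrite -(gtr0_norm r0).
apply: eP; last by rewrite divr_gt0.
by rewrite /ball_/= sub0r normrN gtr0_norm ?divr_gt0//; lra.
Qed.

(** The least exponent with $u\le 2^n$ works: either $n=0$ and $1\le 2u$, or $2^{n-1}<u$ by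
    minimality. *)
Lemma pow2_between (u : R) : 1 <= u ->
  exists n, u <= 2 ^+ n <= 2 * u.
Proof.
move=> u1.
have ex : exists n, u <= 2 ^+ n.
  exists (Num.truncn u).+1; apply/ltW/(lt_le_trans (truncnS_gt u)).
  by rewrite -natrX ler_nat ltnW// ltn_expl.
exists (ex_minn ex); case: ex_minnP => -[|n] un nmin; rewrite un/=.
  by rewrite expr0; lra.
rewrite exprS ler_pM2l// leNgt; apply/negP => /ltW/nmin.
by rewrite ltnn.
Qed.

(** At this time [f] equals $K e^{1+dr}$, and the surplus factor $K e^{dr}$ tends to 0. *)
Lemma decay_power (f : R -> R) (K r d : R) : 1 <= K -> 0 < r -> 0 < d ->
  (forall t, 0 < t -> f t = K / t `^ r) ->
  \forall e \near 0^'+, f (e `^ (- (1 / r + d))) < e / 2.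
Proof.
move=> K1 r0 d0 fE; near=> e.
have e0 : 0 < e by near: e; exact: nbhs_right_gt.
rewrite fE ?powR_gt0// -powRrM -powRN.
have -> : - (- (1 / r + d) * r) = 1 + d * r by field; rewrite gt_eqF.
rewrite powRD ?(gt_eqF e0) ?implybT// powRr1 ?(ltW e0)// mulrCA ltr_pM2l//.
rewrite -ltr_pdivlMl; last by lra.
by near: e; apply: near_powR_lt; rewrite ?mulr_gt0 ?invr_gt0//; lra.
Unshelve. all: by end_near. Qed.

(** The exponential of a negative power of [e] beats every power: [f] is at most $K e^2/c$ here,
    which is below $e/2$ once $e<c/(2K)$. *)
Lemma decay_exp (f : R -> R) (K xi d : R) : 1 <= K -> 0 < xi -> 0 < d ->
  (forall t, 0 < t -> f t = K * expR (- xi * t)) ->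
  \forall e \near 0^'+, f (e `^ (- (0 + d))) < e / 2.
Proof.
(* This [c] results from raising $x\le\exp x$ to the power $2/d$ at $x=(\xi d/2)e^{-d}$: the left
   side becomes $c/e^2$, the right side $\exp(\xi e^{-d})$. *)
move=> K1 xi0 d0 fE; pose c := (xi * d / 2) `^ (2 / d).
have c0 : 0 < c by rewrite powR_gt0// !mulr_gt0.
near=> e.
have e0 : 0 < e by near: e; exact: nbhs_right_gt.
rewrite fE ?powR_gt0// add0r mulNr expRN.
have ce : c / e ^+ 2 <= expR (xi * e `^ (- d)).
  have -> : xi * e `^ (- d) = (xi * d / 2 * e `^ (- d)) * (2 / d).
    by field; rewrite gt_eqF.
  rewrite expRM.
  have -> : c / e ^+ 2 = (xi * d / 2 * e `^ (- d)) `^ (2 / d).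
    rewrite powRM ?powR_ge0//; last by rewrite !mulr_ge0 ?ltW.
    rewrite -powRrM (_ : - d * (2 / d) = - 2%:R) ?powR_invn ?ltW//.
    by field; rewrite gt_eqF.
  apply: ge0_ler_powR; rewrite ?nnegrE ?expR_ge0//.
  - by rewrite divr_ge0 ?ltW.
  - by rewrite !mulr_ge0 ?powR_ge0 ?ltW.
  - by apply: le_trans (expR_ge1Dx _); rewrite lerDr.
apply: (@le_lt_trans _ _ (K * (e ^+ 2 / c))).
  rewrite ler_pM2l; last by lra.
  rewrite -[e ^+ 2 / c]invrK lef_pV2 ?posrE ?expR_gt0 ?invr_gt0 ?divr_gt0 ?exprn_gt0//.
  by rewrite invf_div.
have ec : e < c / (2 * K).
  by near: e; apply: nbhs_right_lt; rewrite divr_gt0//; lra.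
move: ec; rewrite ltr_pdivlMr; last by lra.
rewrite mulrA ltr_pdivrMr// => ec.
nra.
Unshelve. all: by end_near. Qed.

End Asymptotics.

(** * The dimension bound for a family of sections with prescribed decay *)

Section BoxDimension.
Context {R : realType} {X : completeNormedModType R}.
Implicit Types (A : R -> set X) (K L : set X) (r d e a : R).

Lemma hausdorff_semidist_lt K L (u : R) :
  (hausdorff_semidist K L < u%:E)%E ->
  forall x, K x -> exists2 y, L y & `|x - y| < u.
Proof.
rewrite /hausdorff_semidist gt_max => /andP[_ KLu] x Kx.
have /ereal_inf_lt[_ [y Ly <-] xy] :
    (ereal_inf [set `|x - y|%:E | y in L] < u%:E)%E.
  by apply: le_lt_trans KLu; apply: ereal_sup_ubound; exists x.
by exists y.
Qed.

(** With $2^n$ between $2R_0/e$ and $4R_0/e$, the count is $m^n=(2^n)^{\log_2 m}\le(4R_0/e)^{\log_2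
    m}$. *)
Lemma geometric_radius (R0 e : R) (m : nat) :
  1 <= R0 -> 0 < e < 1 -> (0 < m)%N ->
  exists2 n, R0 / 2 ^+ n <= e / 2 &
    (m ^ n)%:R <= (4 * R0) `^ (ln m%:R / ln 2) * e `^ (- (ln m%:R / ln 2)) :> R.
Proof.
move=> R01 /andP[e0 e1] m0; have ln2 : 0 < ln 2 :> R by rewrite ln_gt0// ltr1n.
have [|n /andP[un nu]] := @pow2_between R (2 * R0 / e).
  by rewrite ler_pdivlMr//; lra.
exists n.
  rewrite ler_pdivrMr ?exprn_gt0//; move: un; rewrite ler_pdivrMr//.
  by move: (2 ^+ n) => u; lra.
have -> : (m ^ n)%:R = (2 ^+ n) `^ (ln m%:R / ln 2) :> R.
  rewrite natrX -(@powR_mulrn _ 2)// -powRrM mulrC powRrM powR_mulrn ?powR_ge0//.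
  congr (_ ^+ _).
  by rewrite /powR pnatr_eq0/= divfK ?gt_eqF// lnK// posrE ltr0n.
have -> : e `^ (- (ln m%:R / ln 2)) = e^-1 `^ (ln m%:R / ln 2).
  by rewrite -(powR_inv1 (ltW e0)) -powRrM mulN1r.
rewrite -powRM ?invr_ge0 ?(ltW e0)//; last by lra.
apply: ge0_ler_powR.
- by rewrite divr_ge0 ?(ltW ln2)// ln_ge0// ler1n.
- by rewrite nnegrE exprn_ge0.
- by rewrite nnegrE divr_ge0 ?(ltW e0)//; lra.
- by apply: le_trans nu _; rewrite !mulrA; lra.
Qed.

(** Both decay laws enter only through the exponent [a] of the time after which [f] is below half
    the radius. *)
Lemma box_dim_bigcup_le A (Aminus Aplus : set X) (dminus dplus : R) (f : R -> R)
    (T0 a vartheta C R0 : R) (m : nat) :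
  box_dim Aminus = dminus%:E -> box_dim Aplus = dplus%:E ->
  (forall t t', 0 < t -> t < t' -> f t' < f t) ->
  (forall d, 0 < d -> \forall e \near 0^'+, f (e `^ (- (a + d))) < e / 2) ->
  (forall t, T0 <= t -> t != 0 ->
    (hausdorff_semidist (A t) Aplus <= (f t)%:E)%E) ->
  (forall t, t <= - T0 -> t != 0 ->
    (hausdorff_semidist (A t) Aminus <= (f `|t|)%:E)%E) ->
  0 <= T0 -> 0 <= a -> 0 < vartheta -> 0 < C -> 1 <= R0 -> (0 < m)%N ->
  (forall s t x, s <= t <= s + 1 -> A t x ->
    exists2 y, A s y & `|x - y| <= C * (t - s) `^ vartheta) ->
  (forall t n, coverable (A t) (R0 / 2 ^+ n) (m ^ n)) ->
  (box_dim (\bigcup_t A t) <=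
    (Num.max dplus (Num.max dminus
      (a + 1 / vartheta + ln m%:R / ln 2)))%:E)%E.
Proof.
move=> dimm dimp f_decr f_small distp distm T00 a0 th0 C0 R01 m0 At Acov.
set L := ln m%:R / ln 2; set M := Num.max _ _.
(* All counts are bounded by a constant times $r^{-(M+2d)}$; the remaining $2d$ of the slack [e]
   absorbs the constant. *)
apply: box_dim_le => e e0; pose d := e / 4.
have d0 : 0 < d by rewrite divr_gt0.
have Mp : dplus <= M by rewrite le_max lexx.
have Mm : dminus <= M by rewrite !le_max lexx orbT.
have ML : a + 1 / vartheta + L <= M by rewrite !le_max lexx !orbT.
(* The first term pays for the covers of [Aplus] and [Aminus] at radius [r / 2], the second for the
   sections with [- T <= t <= T]. *)
pose D := 2 * 2 `^ (M + d) + 3 * (4 * R0) `^ L.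
have D0 : 0 < D by rewrite addr_gt0// mulr_gt0// powR_gt0//; lra.
near=> r.
have r0 : 0 < r by near: r; exact: nbhs_right_gt.
have r1 : r < 1 by near: r; exact: nbhs_right_lt.
have r01 : 0 < r < 1 by rewrite r0.
pose T := r `^ (- (a + d)); pose eta := r `^ (1 / vartheta + d).
have T_gt0 : 0 < T by exact: powR_gt0.
have eta_gt0 : 0 < eta by exact: powR_gt0.
have T_ge1 : 1 <= T.
  rewrite /T powRN invf_ge1 ?powR_gt0// -(powRr0 r).
  by apply: ger_powR; rewrite ?r0 ?ltW//; lra.
have eta_le1 : eta <= 1.
  rewrite /eta -[leRHS](powRr0 r); apply: ger_powR; rewrite ?r0 ?(ltW r1)//.
  by rewrite addr_ge0 ?(ltW d0)// divr_ge0 ?(ltW th0)//.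
have TT0 : T0 <= T.
  (* [T0] may be 0, so reciprocals are compared for [T0 + 1]. *)
  apply: (@le_trans _ _ (T0 + 1)); first by rewrite lerDl.
  have T1 : 0 < T0 + 1 by rewrite ltr_wpDl.
  rewrite /T powRN -[leLHS]invrK lef_pV2 ?posrE ?invr_gt0 ?powR_gt0//.
  apply/ltW; near: r; apply: near_powR_lt; first exact: ltr_wpDl.
  by rewrite invr_gt0 ltr_wpDl.
have fT t : T <= t -> f t < r / 2.
  have fT : f T < r / 2 by rewrite /T; near: r; exact: f_small d0.
  rewrite le_eqVlt => /predU1P[<-//|Tt].
  exact: lt_trans (f_decr _ _ T_gt0 Tt) fT.
have half_pow (x : R) : x <= M ->
    (r / 2) `^ (- (x + d)) <= 2 `^ (M + d) * r `^ (- (M + 2 * d)).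
  move=> xM; apply: (@le_trans _ _ ((r / 2) `^ (- (M + d)))).
    by apply: ger_powR; [apply/andP; split; lra|lra].
  rewrite powRM ?invr_ge0 ?(ltW r0)// mulrC.
  rewrite -(@powR_inv1 _ 2)// -powRrM mulN1r opprK ler_pM2l ?powR_gt0//.
  by apply: ger_powR; [rewrite r0 ltW|lra].
have [kp Kp kpr] : exists2 k, coverable Aplus (r / 2) k &
    k%:R < (r / 2) `^ (- (dplus + d)).
  by near: r; exact: near_half (box_dim_coverable dimp d0).
have [km Km kmr] : exists2 k, coverable Aminus (r / 2) k &
    k%:R < (r / 2) `^ (- (dminus + d)).
  by near: r; exact: near_half (box_dim_coverable dimm d0).
have far_p : coverable (\bigcup_(t in [set t | T <= t]) A t) (r / 2 + r / 2) kp.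
  apply: coverable_thicken Kp => x [t /= Tt]; apply: hausdorff_semidist_lt.
  apply: le_lt_trans (distp _ (le_trans TT0 Tt) _) _.
    by rewrite gt_eqF// (lt_le_trans _ Tt).
  by rewrite lte_fin fT.
have far_m :
    coverable (\bigcup_(t in [set t | t <= - T]) A t) (r / 2 + r / 2) km.
  apply: coverable_thicken Km => x [t /= tT]; apply: hausdorff_semidist_lt.
  have t0 : t < 0 by lra.
  have tT0 : t <= - T0 by lra.
  apply: le_lt_trans (distm _ tT0 _) _; first by rewrite lt_eqF.
  by rewrite lte_fin ltr0_norm// fT// lerNr.
have step s t x : s <= t <= s + eta -> A t x ->
    exists2 y, A s y & `|x - y| < r / 2.
  move=> /andP[st ts] Ax; have [|y Ay xy] := At s t x _ Ax.
    by apply/andP; split; lra.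
  exists y => //; apply: (le_lt_trans xy).
  (* By the choice of [eta], $\eta^{\vartheta}=r^{1+d\vartheta}$, and $C r^{d\vartheta}<1/2$ for
     small [r]. *)
  apply: (@le_lt_trans _ _ (C * eta `^ vartheta)).
    by rewrite ler_pM2l//; apply: ge0_ler_powR; rewrite ?nnegrE; lra.
  rewrite /eta -powRrM mulrDl divfK ?gt_eqF//.
  rewrite powRD ?(gt_eqF r0) ?implybT// powRr1 ?(ltW r0)//.
  rewrite mulrCA ltr_pM2l// -ltr_pdivlMl//.
  by near: r; apply: near_powR_lt; rewrite ?mulr_gt0// ?invr_gt0.
have [n nr kr] := geometric_radius R01 r01 m0.
set k := (m ^ n)%N in kr.
have Kk s : coverable (A s) (r / 2) k by exact: coverable_le_radius (Acov s n).
pose q := (Num.truncn (2 * T / eta)).+1.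
have qr : q%:R <= 3 * r `^ (- (a + 1 / vartheta + 2 * d)).
  have Te : T / eta = r `^ (- (a + 1 / vartheta + 2 * d)).
    rewrite /T /eta -powRN -powRD ?(gt_eqF r0) ?implybT//.
    by congr (_ `^ _); lra.
  (* This absorbs the extra grid point: $2T/\eta+1\le 3T/\eta$. *)
  have Te1 : 1 <= T / eta by rewrite ler_pdivlMr// mul1r (le_trans eta_le1).
  have : (Num.truncn (2 * T / eta))%:R <= 2 * T / eta.
    by rewrite truncn_le// divr_ge0// ltW// mulr_gt0.
  by rewrite /q -natr1 -Te; lra.
exists (kp + (km + q * k))%N.
  apply: (@coverable_sub _ _ _ ((\bigcup_(t in [set t | T <= t]) A t) `|`
    ((\bigcup_(t in [set t | t <= - T]) A t) `|`
     (\bigcup_(t in [set t | - T <= t <= T]) A t)))).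
    move=> x [t _ Ax]; have [Tt|tT] := leP T t; first by left; exists t.
    have [tT'|Tt] := leP t (- T); first by right; left; exists t.
    by right; right; exists t => //=; rewrite !ltW.
  rewrite (splitr r); apply: coverableU far_p _; apply: coverableU far_m _.
  exact: coverable_trajectory.
have qk : (q * k)%:R <= 3 * (4 * R0) `^ L * r `^ (- (M + 2 * d)).
  rewrite natrM; apply: (@le_trans _ _ (3 * r `^ (- (a + 1 / vartheta + 2 * d)) *
    ((4 * R0) `^ L * r `^ (- L)))); first exact: ler_pM.
  rewrite mulrACA ler_pM2l; last by rewrite mulr_gt0// powR_gt0//; lra.
  rewrite -powRD ?(gt_eqF r0) ?implybT//.
  by apply: ger_powR; [rewrite r0 ltW|lra].
apply: (@le_trans _ _ (D * r `^ (- (M + 2 * d)))).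
  have := le_trans (ltW kpr) (half_pow _ Mp).
  have := le_trans (ltW kmr) (half_pow _ Mm).
  by rewrite /D natrD (natrD _ km); lra.
have -> : - (M + e) = - (M + 2 * d) + - (2 * d) by rewrite /d; lra.
rewrite powRD ?(gt_eqF r0) ?implybT// mulrC ler_pM2l ?powR_gt0//.
rewrite powRN -[leLHS]invrK lef_pV2 ?posrE ?invr_gt0 ?powR_gt0//.
by apply/ltW; near: r; apply: near_powR_lt; rewrite ?invr_gt0// mulr_gt0.
Unshelve. all: by end_near. Qed.

End BoxDimension.

(** * Translation of the symbol, and the attractor inside the absorbing set *)

Section PullbackAttractor.
Context {R : realType} {X : completeNormedModType R} {Xi : metricType R}.
Context (theta : R -> Xi -> Xi) (Sigma : set Xi) (U : Xi -> R -> R -> X -> X).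
Context (psi : Xi) (A : R -> set X) (B : set X).
Hypothesis Sigma_symbol : symbol_space theta Sigma.
Hypothesis U_system : evolution_system theta Sigma U.
Hypothesis psi_Sigma : Sigma psi.
Hypothesis A_attractor : pullback_attractor (U psi) A.

Lemma shifted_symbol s : Sigma (theta s psi).
Proof. by rewrite -(ss_invariant Sigma_symbol s); exists psi. Qed.

(** Shifting the symbol moves the initial time to 0, the form in which absorption and smoothing are
    stated. *)
Lemma shifted_process s t x : 0 <= t ->
  U (theta s psi) t 0 x = U psi (s + t) s x.
Proof.
by move=> t0; rewrite (U_system.2 psi t 0 s x psi_Sigma t0) add0r addrC.
Qed.

Lemma shifted_invariant s t : 0 <= t ->
  U (theta s psi) t 0 @` A s = A (s + t).
Proof.
move=> t0; rewrite -(pa_invariant A_attractor (_ : s <= s + t)) ?lerDl//.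
by apply: eq_imagel => x _; exact: shifted_process.
Qed.

(** The union of all sections is bounded, hence absorbed after one time [tB] for all symbols, and
    A(t) is the image of A(t - tB) over a time span [tB]. *)
Lemma attractor_sub_absorbing t :
  uniformly_absorbing Sigma U B -> A t `<=` B.
Proof.
move=> /(_ _ (pa_bounded A_attractor))[tB tB0 absB] x.
rewrite -[t](subrK tB) -shifted_invariant// => -[y Ay <-].
apply: (absB tB (theta (t - tB) psi) (lexx _) (shifted_symbol _)).
by exists y => //; exists (t - tB).
Qed.

End PullbackAttractor.

(** * Application to the attractor under the two decay laws *)

Theorem theorem1 (R : realType) (X : completeNormedModType R)
    (Xi : metricType R) (Xi_complete : complete_metric Xi)
    (theta : R -> Xi -> Xi) (Sigma : set Xi)
    (Sigma_symbol : symbol_space theta Sigma)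
    (U : Xi -> R -> R -> X -> X) (U_system : evolution_system theta Sigma U)
    (psi : Xi) (psi_Sigma : Sigma psi)
    (A : R -> set X) (A_attractor : pullback_attractor (U psi) A)
    (B : set X) (B_closed : closed B) (B_bounded : bounded_set B)
    (B_absorbing : uniformly_absorbing Sigma U B)
    (* (1) *)
    (Y : completeNormedModType R) (j : {linear Y -> X})
    (j_compact : compact_embedding j)
    (* (2) *)
    (kappa : R -> R) (kappa_gt0 : forall t, 0 < t -> 0 < kappa t)
    (smoothing : forall t, 0 < t -> forall x y, B x -> B y ->
      (ereal_sup [set embedded_norm j (U sigma t 0 x - U sigma t 0 y)%R
                 | sigma in Sigma] <= (kappa t * `|x - y|)%:E)%E)
    (* (3) *)
    (gamma vartheta : R) (gamma_range : 0 < gamma <= 1)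
    (vartheta_range : 0 < vartheta <= 1) (C : R -> R)
    (holder : forall r, 0 < r -> forall s sigma x y t t',
      Sigma sigma -> B x -> B y -> 0 <= t <= r -> 0 <= t' <= r ->
      `|U sigma (t + s) s x - U sigma (t' + s) s y|
        <= C r * (`|x - y| `^ gamma + `|t - t'| `^ vartheta))
    (* (4) *)
    (Aminus Aplus : set X) (dminus dplus : R)
    (Aminus_dim : box_dim Aminus = dminus%:E)
    (Aplus_dim : box_dim Aplus = dplus%:E)
    (f : R -> R) (f_gt0 : forall t, 0 < t -> 0 < f t)
    (f_decreasing : forall t t', 0 < t -> t < t' -> f t' < f t)
    (f_cvg0 : f t @[t --> +oo%R] --> (0 : R))
    (T0 : R) (T0_ge0 : 0 <= T0)
    (A_forward : forall t, T0 <= t -> t != 0 ->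
      (hausdorff_semidist (A t) Aplus <= (f t)%:E)%E)
    (A_backward : forall t, t <= - T0 -> t != 0 ->
      (hausdorff_semidist (A t) Aminus <= (f `|t|)%:E)%E)
    (tau : R) (tau_gt0 : 0 < tau)
    (B_invariant : forall t, tau <= t ->
      \bigcup_(sigma in Sigma) (U sigma t 0 @` B) `<=` B) :
  let N := covering_number (j @` ball 0 1) (1 / (4 * kappa tau)) in
  (* (T1) *)
  (forall K r : R, 1 <= K -> 0 < r ->
     (forall t, 0 < t -> f t = K / t `^ r) ->
     (box_dim (\bigcup_t A t) <=
        maxe dplus%:E (maxe dminus%:E
          ((1 / r + 1 / vartheta)%R%:E + (1 / gamma)%R%:E * elog2 N)))%E) /\
  (* (T2) *)
  (forall K xi : R, 1 <= K -> 0 < xi ->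
     (forall t, 0 < t -> f t = K * expR (- xi * t)) ->
     (box_dim (\bigcup_t A t) <=
        maxe dplus%:E (maxe dminus%:E
          ((1 / vartheta)%R%:E + (1 / gamma)%R%:E * elog2 N)))%E).
Proof.
have AB t : A t `<=` B by exact: (attractor_sub_absorbing
  Sigma_symbol U_system psi_Sigma A_attractor B_absorbing).
have kt0 := kappa_gt0 tau tau_gt0.
have [R0 R01 AR0] : exists2 R0, 1 <= R0 &
    forall s x y, A s x -> A s y -> `|x - y| < R0.
  have [M [_ AM]] := pa_bounded A_attractor.
  have {}AM s x : A s x -> `|x| <= `|M| + 1.
    move=> Ax; apply: (AM (`|M| + 1)); last by exists s.
    by rewrite (le_lt_trans (ler_norm M))// ltrDl.
  (* Twice the norm bound on the sections; the last 1 gives the strict inequality and [1 <= R0]. *)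
  exists (2 * (`|M| + 1) + 1); first by rewrite lerDr mulr_ge0// addr_ge0.
  move=> s x y Ax Ay; apply: le_lt_trans (ler_normB _ _) _.
  by have := AM _ _ Ax; have := AM _ _ Ay; lra.
have [k Yk] : exists k, coverable (j @` ball 0 1) (1 / (4 * kappa tau)) k.
  apply: precompact_coverable; first by rewrite divr_gt0// mulr_gt0.
  have [_ _] := j_compact; apply.
  exists 1; split=> // M M1 y; rewrite /= mem_ball_norm sub0r normrN => y1.
  exact/ltW/(lt_trans y1).
have [m Ym Nm] := covering_number_attained Yk.
(* The unit ball contains 0, so its cover is not empty; hence $\log_2 m\ge 0$. *)
have m_gt0 : (0 < m)%N.
  have [c Yc] := Ym; apply: leq_trans; have [|b /= bc _] := Yc (j 0).
    by exists 0 => //; exact: ballxx.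
  by case: c bc {Yc}.
have Acov t n : coverable (A t) (R0 / 2 ^+ n) (m ^ n).
  apply: self_coverableW; move: n t.
  apply: (@smoothing_iter_self_coverable _ _ _ j A
    (fun s => U (theta s psi) tau 0) (kappa tau) tau) => //.
  - by rewrite (lt_le_trans _ R01).
  - by move=> s; apply: (shifted_invariant U_system psi_Sigma A_attractor);
      exact: ltW.
  - move=> s x y /AB Bx /AB By; apply: le_trans (smoothing _ tau_gt0 _ _ Bx By).
    apply: ereal_sup_ubound; exists (theta s psi) => //.
    exact: shifted_symbol Sigma_symbol psi_Sigma s.
have Atime s t x : s <= t <= s + 1 -> A t x ->
    exists2 y, A s y & `|x - y| <= (`|C 1| + 1) * (t - s) `^ vartheta.
  move=> /andP[st ts1]; rewrite -(pa_invariant A_attractor st) => -[y Ay <-].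
  have By := AB _ _ Ay; exists y => //.
  (* Both trajectories start at the same [y], so the term with exponent [gamma] vanishes and only
     the time increment remains. *)
  have := holder 1 ltr01 s psi y y (t - s) 0 psi_Sigma By By.
  rewrite lexx ler01 subr_ge0 st lerBlDl ts1 subrK add0r subr0 => /(_ isT isT).
  rewrite (ep_id (U_system.1 _ psi_Sigma)) => /le_trans; apply.
  rewrite subrr normr0 powR0 ?gt_eqF//; last by case/andP: gamma_range.
  rewrite add0r ger0_norm ?subr_ge0// ler_wpM2r ?powR_ge0//.
  by rewrite (le_trans (ler_norm _))// lerDl.
move=> N; have -> : elog2 N = (ln m%:R / ln 2)%:E.
  by rewrite /elog2 /N Nm lne_EFin ?ltr0n// inver gt_eqF// ln_gt0// ltr1n.
have [[g0 g1] [th0 th1]] := (andP gamma_range, andP vartheta_range).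
have ratio_ge0 : 0 <= ln m%:R / ln 2 :> R.
  by rewrite divr_ge0 ?ln_ge0// ler1n.
have main a : 0 <= a ->
    (forall d, 0 < d -> \forall e \near 0^'+, f (e `^ (- (a + d))) < e / 2) ->
    (box_dim (\bigcup_t A t) <= maxe dplus%:E (maxe dminus%:E
      ((a + 1 / vartheta)%:E + (1 / gamma)%:E * (ln m%:R / ln 2)%:E)))%E.
  move=> a0 fa; apply: le_trans (box_dim_bigcup_le Aminus_dim Aplus_dim
    f_decreasing fa A_forward A_backward T0_ge0 a0 th0 _ R01 m_gt0 Atime Acov) _.
    by rewrite ltr_wpDl.
  rewrite -EFinM -EFinD -!EFin_max lee_fin; do 2 apply: le_max2 => //.
  (* Since $\gamma\le 1$ and $\log_2 m\ge 0$, $\log_2 m\le\frac1\gamma\log_2 m$. *)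
  by rewrite lerD2l ler_peMl// div1r invf_ge1.
split=> [K r K1 r0 fE|K xi K1 xi0 fE].
  apply: main; first by rewrite divr_ge0// ltW.
  by move=> d d0; exact: decay_power fE.
rewrite -[X in X%:E + _](add0r); apply: main => // d d0.
exact: decay_exp fE.
Qed.
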